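(* Let $[a_1,a_2,\ldots,a_n]$ be a positive continued fraction, let $\ell_i=a_1+\cdots+a_i$ and $q=-t^{-1}$. Then, up to normalization by its leading term, the Jones polynomial $V_{[a_1,\ldots,a_n]}$ of the 2-bridge link $C[a_1,\ldots,a_n]$ (that is, the quotient of $V_{[a_1,\ldots,a_n]}$ by its leading term) is equal to the following. (a) If $n$ is odd, $$N\Big[[a_1+1]_q-q,\ [a_2]_q\,q^{-\ell_2},\ [a_3]_q\,q^{\ell_2+1},\ldots,[a_{2i}]_q\,q^{-\ell_{2i}},\ [a_{2i+1}]_q\,q^{\ell_{2i}+1},\ldots,[a_n]_q\,q^{\ell_{n-1}+1}\Big].$$ (b) If $n$ is even, $$q^{\ell_n}\,N\Big[[a_1+1]_q-q,\ [a_2]_q\,q^{-\ell_2},\ [a_3]_q\,q^{\ell_2+1},\ldots,[a_{2i}]_q\,q^{-\ell_{2i}},\ [a_{2i+1}]_q\,q^{\ell_{2i}+1},\ldots,[a_n]_q\,q^{-\ell_n}\Big].$$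
   Context: A positive continued fraction is $[a_1,\ldots,a_n]=a_1+1/(a_2+1/(\cdots+1/a_n))$ with all $a_i$ positive integers. For a positive integer $a$, $[a]_q=1+q+q^2+\cdots+q^{a-1}$. The numerator $N[\mathcal L_1,\ldots,\mathcal L_n]$ of a continued fraction of Laurent polynomials is defined recursively by $N[\ ]=1$, $N[\mathcal L_1]=\mathcal L_1$ and $N[\mathcal L_1,\ldots,\mathcal L_n]=\mathcal L_n\,N[\mathcal L_1,\ldots,\mathcal L_{n-1}]+N[\mathcal L_1,\ldots,\mathcal L_{n-2}]$. In the statement the $i$-th entry is $[a_1+1]_q-q$ for $i=1$, $[a_i]_q\,q^{-\ell_i}$ for $i$ even, and $[a_i]_q\,q^{\ell_{i-1}+1}$ for odd $i\ge3$. The link $C[a_1,\ldots,a_n]$ is the 2-bridge link with the alternating Conway diagram made of $n$ successive 2-strand braids with $a_1,\ldots,a_n$ crossings. Concretely: take four horizontal strands in positions $1,2,3,4$ and, from left to right, the braid $\sigma_2^{-a_1}\sigma_1^{a_2}\sigma_2^{-a_3}\cdots$ ($i$-th factor $\sigma_2^{-a_i}$ for $i$ odd, $\sigma_1^{a_i}$ for $i$ even), where $\sigma_j$ crosses the strands in positions $j,j+1$ by a crossing that is positive when both strands are oriented left to right. On the left join ends $1$–$2$ and $3$–$4$; on the right join $1$–$2$ and $3$–$4$ if $n$ is odd, and $2$–$3$ and $1$–$4$ (nested arcs) if $n$ is even. Choose any orientation of the components (changing it multiplies the Jones polynomial only by a power of $t$). Jones polynomial: $V(\text{unknot})=1$ and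 $t^{-1}V(L_+)-t\,V(L_-)+(t^{-1/2}-t^{1/2})V(L_0)=0$ for oriented links $L_+,L_-,L_0$ that agree except near one point, where they have a positive crossing, a negative crossing, and the oriented smoothing respectively. The leading term of a Laurent polynomial in $t^{1/2}$ is its term (with coefficient) of highest exponent. *)

(* Defs.v *)
From Stdlib Require Import Relation_Operators.
From HB Require Import structures.
From mathcomp Require Import all_boot all_order all_algebra.

Set Implicit Arguments.
Unset Strict Implicit.
Unset Printing Implicit Defensive.

Import GRing.Theory.
Local Open Scope ring_scope.

(* Oriented links are presented by oriented plane diagrams in Morse position,
   read from left to right and cut into elementary slices.  A slice (i, g)
   applies the generator g to the strands in (0-based) positions i, i.+1 and is
   the identity elsewhere:
   - [cup o] opens a left arc, creating two strands at positions i, i.+1;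
   - [cap] joins the strands at positions i, i.+1 by a right arc;
   - [cross true] / [cross false] is the braid generator sigma / its inverse,
     where sigma is the crossing that is positive when both of its strands are
     oriented left to right.
   A vertical cross-section of a diagram is the sequence of the directions of
   its strands, with [true] for left to right. *)
Inductive generator := cup of bool | cap | cross of bool.

Definition slice := (nat * generator)%type.

Definition act (sl : slice) (st : seq bool) : option (seq bool) :=
  let: (i, g) := sl in
  match g with
  | cup o =>
      if (i <= size st)%N then Some (take i st ++ [:: o, ~~ o & drop i st])
      else None
  | cap =>
      if drop i st is x :: y :: r then
        if x == ~~ y then Some (take i st ++ r) else None
      else None
  | cross _ =>
      if drop i st is x :: y :: r then Some (take i st ++ [:: y, x & r])
      else None
  end.

Definition run (w : seq slice) (st : seq bool) : option (seq bool) :=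
  foldl (fun o sl => obind (act sl) o) (Some st) w.

Definition is_closed (w : seq slice) : bool := run w [::] == Some [::].

Record diagram := Diagram { word :> seq slice; word_closed : is_closed word }.

Definition width_in (g : generator) : nat := if g is cup _ then 0%N else 2%N.
Definition width_out (g : generator) : nat := if g is cap then 0%N else 2%N.

(* The Turaev moves: two diagrams present isotopic links iff they are related by
   these local moves.  The first five generate the planar isotopies (and the
   sliding of a crossing around a left or right arc), the others are the
   Reidemeister moves. *)
Inductive move : seq slice -> seq slice -> Prop :=
| move_far i j f g of (i <= j)%N :
    move [:: (i, f); ((j + width_out f)%N, g)]
         [:: ((j + width_in f)%N, g); (i, f)]
| move_zigzag_l i o : move [:: (i, cup o); (i.+1, cap)] [::]
| move_zigzag_r i o : move [:: (i.+1, cup o); (i, cap)] [::]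
| move_slide_cup i o s :
    move [:: (i, cup o); (i.+1, cross s)] [:: (i.+1, cup o); (i, cross (~~ s))]
| move_slide_cap i s :
    move [:: (i, cross s); (i.+1, cap)] [:: (i.+1, cross (~~ s)); (i, cap)]
| move_R1_cup i o s : move [:: (i, cup o); (i, cross s)] [:: (i, cup (~~ o))]
| move_R1_cap i s : move [:: (i, cross s); (i, cap)] [:: (i, cap)]
| move_R2 i s : move [:: (i, cross s); (i, cross (~~ s))] [::]
| move_R3 i s :
    move [:: (i, cross s); (i.+1, cross s); (i, cross s)]
         [:: (i.+1, cross s); (i, cross s); (i.+1, cross s)].

Definition isotopy_step (D D' : diagram) : Prop :=
  exists u v w w' : seq slice,
    [/\ move w w', word D = u ++ w ++ v & word D' = u ++ w' ++ v].

Definition isotopic : diagram -> diagram -> Prop :=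
  clos_refl_sym_trans diagram isotopy_step.

Lemma unknot_closed (o : bool) : is_closed [:: (0%N, cup o); (0%N, cap)].
Proof. by case: o. Qed.

Definition unknot (o : bool) : diagram := Diagram (unknot_closed o).

(* Reversing one of the two strands changes the sign of a crossing, so the
   positive crossing between strands entering from the left cross-section with
   directions x, y is [cross (x == y)].  The smoothing compatible with the
   orientations is the identity if the strands are parallel, and a right arc
   followed by a left arc if they are antiparallel. *)
Definition oriented_smoothing (i : nat) (x y : bool) : seq slice :=
  if x == y then [::] else [:: (i, cap); (i, cup y)].

Definition skein_triple (Dp Dm D0 : diagram) : Prop :=
  exists (u v : seq slice) (l r : seq bool) (x y : bool),
    [/\ run u [::] = Some (l ++ [:: x, y & r]),
        word Dp = u ++ [:: (size l, cross (x == y))] ++ v,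
        word Dm = u ++ [:: (size l, cross (x != y))] ++ v
      & word D0 = u ++ oriented_smoothing (size l) x y ++ v].

(* Laurent polynomials in t^(1/2) are taken inside the field of fractions of
   Z[X], where X stands for t^(1/2). *)
Definition ratfun := {fraction {poly int}}.
Definition emb (p : {poly int}) : ratfun := @FracField.tofrac {poly int} p.

Definition sqrt_t : ratfun := emb 'X.
Definition t : ratfun := sqrt_t ^+ 2.
Definition q : ratfun := - t^-1.

Definition is_laurent (f : ratfun) : Prop :=
  exists (p : {poly int}) (k : nat), f = emb p / sqrt_t ^+ k.

Definition is_leading_term (f m : ratfun) : Prop :=
  exists (p : {poly int}) (k : nat),
    [/\ p != 0, f = emb p / sqrt_t ^+ k
      & m = emb (lead_coef p *: 'X^((size p).-1)) / sqrt_t ^+ k].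

(* These properties determine V on all links. *)
Record is_jones (V : diagram -> ratfun) : Prop := IsJones {
  jones_laurent : forall D, is_laurent (V D);
  jones_isotopic : forall D D', isotopic D D' -> V D = V D';
  jones_unknot : forall o, V (unknot o) = 1;
  jones_skein : forall Dp Dm D0, skein_triple Dp Dm D0 ->
    t^-1 * V Dp - t * V Dm + (sqrt_t^-1 - sqrt_t) * V D0 = 0 }.

(* The sequence a_1, ..., a_n is given by a function a : nat -> nat of which only
   the values at 1, ..., n matter. *)
Definition conway_braid (n : nat) (a : nat -> nat) : seq slice :=
  flatten [seq nseq (a i) (if odd i then (1%N, cross false)
                           else (0%N, cross true)) | i <- iota 1 n].

(* Every component of C[a_1, ..., a_n] runs through one of the two left arcs, so
   an orientation of the link is given by the directions o1, o2 of these arcs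
   (those for which the resulting word is closed). *)
Definition conway_word (n : nat) (a : nat -> nat) (o1 o2 : bool) : seq slice :=
  [:: (0%N, cup o1); (2%N, cup o2)] ++ conway_braid n a ++
  (if odd n then [:: (2%N, cap); (0%N, cap)] else [:: (1%N, cap); (0%N, cap)]).

Fixpoint numer_cf (L : nat -> ratfun) (n : nat) : ratfun :=
  match n with
  | 0 => 1
  | 1 => L 1%N
  | (m.+1 as k).+1 => L n * numer_cf L k + numer_cf L m
  end.

Definition qint (m : nat) : ratfun := \sum_(k < m) q ^+ k.

Definition ell (a : nat -> nat) (i : nat) : nat := (\sum_(1 <= j < i.+1) a j)%N.

Definition cf_entry (a : nat -> nat) (i : nat) : ratfun :=
  if i == 1%N then qint (a 1%N).+1 - q
  else if odd i then qint (a i) * q ^+ (ell a i.-1).+1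
  else qint (a i) * q ^- (ell a i).

(* Main.v *)
(* The closed formula
     V = sqrt_t ^ (3 p) * twist_unit * twist_poly,
   where p is the number of positive crossings, holds for all oriented diagrams
   C[a_1, ..., a_n] with a_i >= 0, by induction on n and then on a_n.
   - If a_n >= 2, the skein relation at a crossing of the last twist relates a_n
     to a_n - 2 (Reidemeister II) and to the oriented smoothing.  If the strands
     of the twist are parallel, the smoothing is a_n - 1; if they are
     antiparallel, it opens the twist, the remaining crossings are kinks, and
     what is left is C[a_1, ..., a_(n-1)].
   - If a_n = 1, the crossing slides around the right arcs and joins the
     previous twist, which gives C[a_1, ..., a_(n-1) + 1].
   - If a_n = 0, the previous twist consists of kinks, which gives
     C[a_1, ..., a_(n-2)].
   The factor sqrt_t ^ (3 p) twist_unit is a monomial.  The recursion for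
   twist_poly, the numerator of the continued fraction with denominators
   cleared, shows that it is a polynomial in q = - t^-1 with constant term 1 if
   all a_i are positive, so the monomial is the leading term. *)

From Stdlib Require Import Relation_Operators.
Require Import Defs.
From mathcomp Require Import all_boot all_order all_algebra.
From mathcomp Require Import ring.

Set Implicit Arguments.
Unset Strict Implicit.
Unset Printing Implicit Defensive.

Import GRing.Theory.
Local Open Scope ring_scope.

(** * Cross-sections along a word and positive crossings *)

Lemma run_cat u v st : run (u ++ v) st = obind (run v) (run u st).
Proof.
rewrite /run foldl_cat; case: (foldl _ _ u) => //=.
by elim: v.
Qed.

Lemma run_cat_some u v st st' :
  run u st = Some st' -> run (u ++ v) st = run v st'.
Proof. by rewrite run_cat => ->. Qed.

Lemma is_closed_cat u v st : run u [::] = Some st ->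
  is_closed (u ++ v) = (run v st == Some [::]).
Proof. by move=> hu; rewrite /is_closed run_cat hu. Qed.

(** The sign of a crossing depends on the directions of its strands, so the cross-section is carried
    along the word. From a slice that cannot act onwards the count is 0. *)
Fixpoint positive_crossings (w : seq slice) (st : seq bool) : nat :=
  if w is sl :: w' then
    ((if sl is (i, cross s) then
        if drop i st is x :: y :: _ then s == (x == y) else 0
      else 0)
     + (if act sl st is Some st' then positive_crossings w' st' else 0))%N
  else 0%N.

Lemma positive_crossings_cat u v st st' : run u st = Some st' ->
  positive_crossings (u ++ v) st
  = (positive_crossings u st + positive_crossings v st')%N.
Proof.
elim: u st => [|sl u IHu] st /=; first by case=> ->.
have -> : run (sl :: u) st = obind (run u) (act sl st).
  exact: run_cat [:: sl] u st.
by case: (act sl st) => [st1|//] hu; rewrite (IHu _ hu) addnA.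
Qed.

Lemma run_twist1 k s x1 x2 x3 x4 :
  run (nseq k (1%N, cross s)) [:: x1; x2; x3; x4]
  = Some (if odd k then [:: x1; x3; x2; x4] else [:: x1; x2; x3; x4]).
Proof.
elim: k x2 x3 => [|k IHk] x2 x3 //=.
rewrite -[_ :: nseq _ _]/([:: (1%N, cross s)] ++ nseq k (1%N, cross s)).
by rewrite (@run_cat_some _ _ _ [:: x1; x3; x2; x4]) // IHk; case: odd.
Qed.

Lemma run_twist0 k s x1 x2 x3 x4 :
  run (nseq k (0%N, cross s)) [:: x1; x2; x3; x4]
  = Some (if odd k then [:: x2; x1; x3; x4] else [:: x1; x2; x3; x4]).
Proof.
elim: k x1 x2 => [|k IHk] x1 x2 //=.
rewrite -[_ :: nseq _ _]/([:: (0%N, cross s)] ++ nseq k (0%N, cross s)).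
by rewrite (@run_cat_some _ _ _ [:: x2; x1; x3; x4]) // IHk; case: odd.
Qed.

Lemma positive_crossings_twist1 k s x1 x2 x3 x4 :
  positive_crossings (nseq k (1%N, cross s)) [:: x1; x2; x3; x4]
  = (k * (s == (x2 == x3)))%N.
Proof.
elim: k x2 x3 => [|k IHk] x2 x3 //=.
by rewrite IHk mulSn (eq_sym x3).
Qed.

Lemma positive_crossings_twist0 k s x1 x2 x3 x4 :
  positive_crossings (nseq k (0%N, cross s)) [:: x1; x2; x3; x4]
  = (k * (s == (x1 == x2)))%N.
Proof.
elim: k x1 x2 => [|k IHk] x1 x2 //=.
by rewrite IHk mulSn (eq_sym x2).
Qed.

Definition caps_odd : seq slice := [:: (2%N, cap); (0%N, cap)].
Definition caps_even : seq slice := [:: (1%N, cap); (0%N, cap)].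

(** * Scalars, the solved skein relation and $q$-integers *)

Lemma emb_neq0 (p : {poly int}) : p != 0 -> emb p != 0.
Proof. by rewrite /emb tofrac_eq0. Qed.

Lemma sqrt_t_neq0 : sqrt_t != 0.
Proof. by apply: emb_neq0; rewrite polyX_eq0. Qed.

Lemma sqrt_tV_neq : sqrt_t^-1 - sqrt_t != 0.
Proof.
have X0 := sqrt_t_neq0.
rewrite subr_eq0 -(inj_eq (mulfI X0)) divff // -expr2 /sqrt_t /emb.
rewrite -tofracXn -tofrac1 tofrac_eq.
by rewrite eq_sym -subr_eq0 -size_poly_eq0 size_XnsubC.
Qed.

Lemma skein_solve_neg (F : fieldType) (x A B C : F) : x != 0 ->
  (x ^+ 2)^-1 * A - x ^+ 2 * B + (x^-1 - x) * C = 0 ->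
  B = (x ^+ 2)^-1 * ((x ^+ 2)^-1 * A + (x^-1 - x) * C).
Proof.
move=> X0 h; apply/eqP; rewrite -subr_eq0; apply/eqP.
transitivity
  (- (x ^+ 2)^-1 * ((x ^+ 2)^-1 * A - x ^+ 2 * B + (x^-1 - x) * C)).
  by field.
by rewrite h mulr0.
Qed.

Lemma skein_solve_pos (F : fieldType) (x A B C : F) : x != 0 ->
  (x ^+ 2)^-1 * A - x ^+ 2 * B + (x^-1 - x) * C = 0 ->
  A = x ^+ 2 * (x ^+ 2 * B - (x^-1 - x) * C).
Proof.
move=> X0 h; apply/eqP; rewrite -subr_eq0; apply/eqP.
transitivity (x ^+ 2 * ((x ^+ 2)^-1 * A - x ^+ 2 * B + (x^-1 - x) * C)).
  by field.
by rewrite h mulr0.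
Qed.

Lemma qint0 : qint 0 = 0.
Proof. by rewrite /qint big_ord0. Qed.

Lemma qintS k : qint k.+1 = qint k + q ^+ k.
Proof. by rewrite /qint big_ord_recr. Qed.

Lemma qint_geometric k : q ^+ k = 1 + (q - 1) * qint k.
Proof. by rewrite -subrX1 addrC subrK. Qed.

Lemma positive_crossings_caps_odd x1 x2 x3 x4 :
  positive_crossings caps_odd [:: x1; x2; x3; x4] = 0%N.
Proof. by case: x1 x2 x3 x4 => [] [] [] []. Qed.

Lemma positive_crossings_caps_even x1 x2 x3 x4 :
  positive_crossings caps_even [:: x1; x2; x3; x4] = 0%N.
Proof. by case: x1 x2 x3 x4 => [] [] [] []. Qed.

Lemma mulr_distr (R : comNzRingType) (a b c d e : R) :
  a * b * (c * d + e) = a * (c * (b * d) + b * e).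
Proof. by ring. Qed.

Lemma mulr_distr3 (R : comNzRingType) (a b c d e f g : R) :
  a * b * (c * d + e * f * g) = a * (c * (b * d) + e * (f * b * g)).
Proof. by ring. Qed.

(* In the four step lemmas, [y] and [w] are the contributions of the positive
   crossings, [g], [r] and [z] stand for [qint k], [q ^+ k] and
   [(- sqrt_t^-1) ^+ k], [e] is the value of the diagram whose last twist is
   opened by the antiparallel smoothing, and [p] is, up to a unit, the value of
   the diagram without its last twist. *)
Section SkeinAlgebra.
Variables (F : fieldType) (x y w z g r e p : F).
Hypothesis x_neq0 : x != 0.
Let v : F := - (x ^+ 2)^-1.

Lemma odd_parallel_step :
  (x ^+ 2)^-1 * ((x ^+ 2)^-1 * (y * (- x * z * (v * g * e + p)))
    + (x^-1 - x) * (y * (- x * (- x^-1 * z) * (v * (g + r) * e + p))))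
  = y * (- x * (- x^-1 * (- x^-1 * z)) * (v * (g + r + v * r) * e + p)).
Proof. by rewrite /v; field. Qed.

Lemma odd_antiparallel_step : w * z * r = 1 ->
  x ^+ 2 * (x ^+ 2 * (y * w * (- x * z * (v * g * e + p)))
    - (x^-1 - x) * (y * e))
  = y * (x ^+ 3 * (x ^+ 3 * w))
    * (- x * (- x^-1 * (- x^-1 * z)) * (v * (g + r + v * r) * e + p)).
Proof.
move=> h; have -> : y * e = y * e * (w * z * r) by rewrite h mulr1.
by rewrite /v; field.
Qed.

Lemma even_parallel_step :
  x ^+ 2 * (x ^+ 2 * (y * w * (- x^-1 * (g * e + r * p)))
    - (x^-1 - x) * (y * (x ^+ 3 * w) * (- x^-1 * ((g + r) * e + v * r * p))))
  = y * (x ^+ 3 * (x ^+ 3 * w))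
    * (- x^-1 * ((g + r + v * r) * e + v * (v * r) * p)).
Proof. by rewrite /v; field. Qed.

Lemma even_antiparallel_step : r = 1 + (v - 1) * g ->
  (x ^+ 2)^-1 * ((x ^+ 2)^-1 * (y * (- x^-1 * (g * e + r * p)))
    + (x^-1 - x) * (y * e))
  = y * (- x^-1 * ((g + r + v * r) * e + v * (v * r) * p)).
Proof. by move=> ->; rewrite /v; field. Qed.

(** The three bases have product $x^3\cdot(-x^{-1})\cdot(-x^{-2})=1$. This supplies the hypothesis
    [w * z * r = 1] of [odd_antiparallel_step]. *)
Lemma odd_antiparallel_scale k : (x ^+ 3) ^+ k * (- x^-1) ^+ k * v ^+ k = 1.
Proof.
rewrite -!exprMn /v.
by have -> : x ^+ 3 * - x^-1 * - (x ^+ 2)^-1 = 1; [field | rewrite expr1n].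
Qed.

(** Rewrites the factor $x^{-3k}$ left by $k$ positive kinks as a power of [v] times the unit of an
    odd-numbered twist, by the preceding identity. *)
Lemma kink_scale k :
  (x ^+ 3) ^- k * (e * p)
  = - x^-1 * (v ^+ k * (- x * (- x^-1) ^+ k * e) * p).
Proof.
have x3 : (x ^+ 3) ^+ k != 0 by rewrite !expf_neq0.
apply: (mulfI x3); rewrite mulVKf //.
rewrite -[LHS]mul1r -{1}(odd_antiparallel_scale k).
by field.
Qed.

(** The skein relation when both signs of the crossing give the unknot; [U] is then the value of the
    two-component unlink. *)
Lemma unlink_value (U : F) : x^-1 - x != 0 ->
  (x ^+ 2)^-1 * 1 - x ^+ 2 * 1 + (x^-1 - x) * U = 0 -> U = - x * (1 - v).
Proof.
move=> ne h; apply: (mulfI ne); apply/eqP; rewrite -subr_eq0 -{1}h.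
by apply/eqP; rewrite /v; field.
Qed.

End SkeinAlgebra.

(** * Words built from twists and the ingredients of the closed formula *)

Definition cups (o1 o2 : bool) : seq slice := [:: (0%N, cup o1); (2%N, cup o2)].

Lemma run_cups o1 o2 : run (cups o1 o2) [::] = Some [:: o1; ~~ o1; o2; ~~ o2].
Proof. by []. Qed.

(* The numbers of crossings are listed from the last twist to the first. *)
Fixpoint twists (s : seq nat) : seq slice :=
  if s is k :: s' then
    twists s' ++ nseq k (if odd (size s) then (1%N, cross false)
                         else (0%N, cross true))
  else [::].

(* The numerator of the continued fraction, multiplied by [q ^+ ell a n] for
   even [n]: this clears its negative powers of [q]. *)
Fixpoint twist_poly (s : seq nat) : ratfun :=
  match s with
  | [::] => 1
  | [:: k] => q * qint k + (1 - q)
  | k :: ((b :: s'') as s') =>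
      if odd (size s) then q * qint k * twist_poly s' + twist_poly s''
      else qint k * twist_poly s' + q ^+ (k + b) * twist_poly s''
  end.

Lemma twist_poly_cons2 k b s : twist_poly [:: k, b & s]
  = if odd (size s) then q * qint k * twist_poly (b :: s) + twist_poly s
    else qint k * twist_poly (b :: s) + q ^+ (k + b) * twist_poly s.
Proof. by rewrite [LHS]/= negbK. Qed.

Lemma qintSl k : qint k.+1 = 1 + q * qint k.
Proof.
by rewrite qintS qint_geometric mulrBl mul1r [RHS]addrC addrCA subrKC addrC.
Qed.

(** A single crossing in the next twist is absorbed into this one. This puts the resulting value
    into the shape [q * e + p] expected by [has_value_twist_odd]; the next lemma does the same for
    [has_value_twist_even]. *)
Lemma twist_poly_succ_even k s : odd (size s) ->
  twist_poly (k.+1 :: s) = q * twist_poly (k :: s) + twist_poly s.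
Proof.
case: s => // b s /= /negbTE os; rewrite os /= qintSl addSn exprS.
by rewrite mulrDl mul1r mulrDr !mulrA -addrA addrC.
Qed.

Lemma twist_poly_succ_odd k s : ~~ odd (size s) ->
  twist_poly (k.+1 :: s) = twist_poly (k :: s) + q ^+ k.+1 * twist_poly s.
Proof.
case: s => [_|b s] /=; last rewrite negbK => os.
  by rewrite qintS exprS mulr1 mulrDr addrAC.
by rewrite os /= qintS exprS mulrDr mulrDl addrAC.
Qed.

(* The part of the leading term that does not depend on the orientation; each
   positive crossing contributes a further [sqrt_t ^+ 3]. *)
Fixpoint twist_unit (s : seq nat) : ratfun :=
  if s is k :: s' then
    (if odd (size s) then - sqrt_t * (- sqrt_t^-1) ^+ k else - sqrt_t^-1)
    * twist_unit s'
  else 1.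

Lemma twists_succ k s : twists (k.+1 :: s) = twists (k :: s)
  ++ [:: if odd (size s).+1 then (1%N, cross false) else (0%N, cross true)].
Proof.
by rewrite -[LHS]/(twists s ++ nseq k.+1 _) -(addn1 k) nseqD catA.
Qed.

Definition caps (n : nat) : seq slice := if odd n then caps_odd else caps_even.

Lemma run_twists o1 o2 s : exists x1 x2 x3 x4,
  run (cups o1 o2 ++ twists s) [::] = Some [:: x1; x2; x3; x4].
Proof.
elim: s => [|k s [x1 [x2 [x3 [x4 IHs]]]]].
  by exists o1, (~~ o1), o2, (~~ o2).
rewrite [twists _]/= catA (run_cat_some _ IHs); case: odd.
  by rewrite run_twist0; case: odd; do 4!eexists.
by rewrite run_twist1; case: odd; do 4!eexists.
Qed.

(** * The Jones polynomial on words and its invariance under local moves *)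

Section JonesOfWords.
Variables (V : diagram -> ratfun) (hV : is_jones V).

(** Extended by 0 to words that are not closed, so that words can be rewritten without carrying
    closedness proofs. *)
Definition jones_word (w : seq slice) : ratfun :=
  if is_closed w =P true is ReflectT h then V (Diagram h) else 0.

Lemma jones_wordE D : jones_word (word D) = V D.
Proof.
case: D => w h; rewrite /jones_word [word _]/=.
case: (is_closed w =P true) => [h'|nh]; last by case: (nh h).
by rewrite (bool_irrelevance h h').
Qed.

Lemma jones_wordT w (h : is_closed w) : jones_word w = V (Diagram h).
Proof. by rewrite -jones_wordE. Qed.

Lemma jones_wordF w : ~~ is_closed w -> jones_word w = 0.
Proof.
rewrite /jones_word => /negP nh.
by case: (is_closed w =P true) => [h|//]; case: (nh h).
Qed.

(** Equality in every context that reaches the cross-section [st]. Fixing [st] matters because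
    whether a local word can act depends on the directions. *)
Definition jones_eq (st : seq bool) (w w' : seq slice) : Prop :=
  forall u v, run u [::] = Some st ->
  jones_word (u ++ w ++ v) = jones_word (u ++ w' ++ v).

(** Since both sides run alike from [st], they are closed in the same contexts: either isotopy
    invariance applies or both values are the default 0. *)
Lemma jones_eq_move pre post st w w' : move w w' ->
  run (pre ++ w ++ post) st = run (pre ++ w' ++ post) st ->
  jones_eq st (pre ++ w ++ post) (pre ++ w' ++ post).
Proof.
move=> hm hr u v hu.
have hc: is_closed (u ++ (pre ++ w ++ post) ++ v)
       = is_closed (u ++ (pre ++ w' ++ post) ++ v).
  by rewrite !(is_closed_cat _ hu) 2!(run_cat (pre ++ _)) hr.
have [h|h] := boolP (is_closed (u ++ (pre ++ w ++ post) ++ v)); last first.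
  by rewrite !jones_wordF -?hc.
have h' := h; rewrite hc in h'.
rewrite (jones_wordT h) (jones_wordT h'); apply: (jones_isotopic hV).
apply: rst_step; exists (u ++ pre), (post ++ v), w, w'.
by split=> //=; rewrite -!catA.
Qed.

Lemma jones_eq_sym st w w' : jones_eq st w w' -> jones_eq st w' w.
Proof. by move=> h u v hu; rewrite h. Qed.

Lemma jones_eq_trans w2 st w1 w3 :
  jones_eq st w1 w2 -> jones_eq st w2 w3 -> jones_eq st w1 w3.
Proof. by move=> h h' u v hu; rewrite h // h'. Qed.

Lemma jones_eq_word u st w w' : run u [::] = Some st ->
  jones_eq st w w' -> jones_word (u ++ w) = jones_word (u ++ w').
Proof. by move=> hu /(_ u [::] hu); rewrite !cats0. Qed.

(** Both crossings and the smoothing lead to the same cross-section, so the three words are closed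
    simultaneously; otherwise all three values are 0. *)
Lemma jones_word_skein u v l r x y : run u [::] = Some (l ++ [:: x, y & r]) ->
  t^-1 * jones_word (u ++ [:: (size l, cross (x == y))] ++ v)
  - t * jones_word (u ++ [:: (size l, cross (x != y))] ++ v)
  + (sqrt_t^-1 - sqrt_t)
    * jones_word (u ++ oriented_smoothing (size l) x y ++ v)
  = 0.
Proof.
move=> hu.
have hX s : run [:: (size l, cross s)] (l ++ [:: x, y & r])
          = Some (l ++ [:: y, x & r]).
  by rewrite /run /= drop_size_cat // take_size_cat.
have h0 : run (oriented_smoothing (size l) x y) (l ++ [:: x, y & r])
          = Some (l ++ [:: y, x & r]).
  rewrite /oriented_smoothing; case: eqP => [->//|/eqP nxy].
  rewrite /run /= drop_size_cat // take_size_cat //.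
  have -> : x == ~~ y by case: (x) (y) nxy => [] [].
  rewrite /= size_cat leq_addr take_size_cat // drop_size_cat //.
  by case: (x) (y) nxy => [] [].
have hc w : run w (l ++ [:: x, y & r]) = Some (l ++ [:: y, x & r]) ->
   is_closed (u ++ w ++ v) = (run v (l ++ [:: y, x & r]) == Some [::]).
  by move=> hw; rewrite (is_closed_cat _ hu) (run_cat_some _ hw).
have [h|h] := boolP (run v (l ++ [:: y, x & r]) == Some [::]); last first.
  by rewrite !jones_wordF ?hc // !mulr0 subr0 addr0.
have hp : is_closed (u ++ [:: (size l, cross (x == y))] ++ v) by rewrite hc.
have hm : is_closed (u ++ [:: (size l, cross (x != y))] ++ v) by rewrite hc.
have hs : is_closed (u ++ oriented_smoothing (size l) x y ++ v) by rewrite hc.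
rewrite (jones_wordT hp) (jones_wordT hm) (jones_wordT hs).
by apply: (jones_skein hV); exists u, v, l, r, x, y.
Qed.

(* Sliding the crossing around both right arcs. *)
Lemma jones_eq_slide s x1 x2 x3 x4 :
  jones_eq [:: x1; x2; x3; x4] ((1%N, cross s) :: caps_odd)
                               ((0%N, cross (~~ s)) :: caps_even).
Proof.
apply: jones_eq_sym.
apply: (@jones_eq_trans [:: (1%N, cross s); (0%N, cap); (0%N, cap)]).
  rewrite -{2}[s]negbK.
  apply: (@jones_eq_move [::] [:: (0%N, cap)] _ _ _ (move_slide_cap 0 (~~ s))).
  by case: s x1 x2 x3 x4 => [] [] [] [] [].
apply: (@jones_eq_move [:: (1%N, cross s)] [::] _ _ _
          (@move_far 0 0 cap cap isT)).
by case: s x1 x2 x3 x4 => [] [] [] [] [].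
Qed.

Lemma jones_eq_kink_even s x1 x2 x3 x4 :
  jones_eq [:: x1; x2; x3; x4] ((1%N, cross s) :: caps_even) caps_even.
Proof.
apply: (@jones_eq_move [::] [:: (0%N, cap)] _ _ _ (move_R1_cap 1 s)).
by case: s x1 x2 x3 x4 => [] [] [] [] [].
Qed.

Lemma jones_eq_kink_odd s x1 x2 x3 x4 :
  jones_eq [:: x1; x2; x3; x4] ((0%N, cross s) :: caps_odd) caps_odd.
Proof.
apply: (@jones_eq_trans [:: (2%N, cap); (0%N, cross s); (0%N, cap)]).
  apply: (@jones_eq_move [::] [:: (0%N, cap)] _ _ _
            (@move_far 0 0 (cross s) cap isT)).
  by case: s x1 x2 x3 x4 => [] [] [] [] [].
apply: (@jones_eq_move [:: (2%N, cap)] [::] _ _ _ (move_R1_cap 0 s)).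
by case: s x1 x2 x3 x4 => [] [] [] [] [].
Qed.

Lemma jones_word_kinks_even u k s x1 x2 x3 x4 :
  run u [::] = Some [:: x1; x2; x3; x4] ->
  jones_word (u ++ nseq k (1%N, cross s) ++ caps_even)
  = jones_word (u ++ caps_even).
Proof.
elim: k u x2 x3 => [|k IHk] u x2 x3 hu //.
have hu' : run (u ++ [:: (1%N, cross s)]) [::] = Some [:: x1; x3; x2; x4].
  by rewrite run_cat hu.
have -> : u ++ nseq k.+1 (1%N, cross s) ++ caps_even
        = (u ++ [:: (1%N, cross s)]) ++ nseq k (1%N, cross s) ++ caps_even.
  by rewrite -catA.
rewrite (IHk _ _ _ hu') -catA.
by apply: (jones_eq_word hu); apply: jones_eq_kink_even.
Qed.

Lemma jones_word_kinks_odd u k s x1 x2 x3 x4 :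
  run u [::] = Some [:: x1; x2; x3; x4] ->
  jones_word (u ++ nseq k (0%N, cross s) ++ caps_odd)
  = jones_word (u ++ caps_odd).
Proof.
elim: k u x1 x2 => [|k IHk] u x1 x2 hu //.
have hu' : run (u ++ [:: (0%N, cross s)]) [::] = Some [:: x2; x1; x3; x4].
  by rewrite run_cat hu.
have -> : u ++ nseq k.+1 (0%N, cross s) ++ caps_odd
        = (u ++ [:: (0%N, cross s)]) ++ nseq k (0%N, cross s) ++ caps_odd.
  by rewrite -catA.
rewrite (IHk _ _ _ hu') -catA.
by apply: (jones_eq_word hu); apply: jones_eq_kink_odd.
Qed.

Lemma jones_word_R2 u v i s st : run u [::] = Some st ->
  run [:: (i, cross s); (i, cross (~~ s))] st = Some st ->
  jones_word (u ++ [:: (i, cross s); (i, cross (~~ s))] ++ v)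
  = jones_word (u ++ v).
Proof.
move=> hu hr.
by have := @jones_eq_move [::] [::] st _ _ (move_R2 i s) hr u v hu.
Qed.

(** * The skein relation at the last crossing of a twist *)

(** Between parallel strands [cross false] is negative, so [f k.+2] is the $L_-$ term. Switching its
    last crossing cancels two crossings, smoothing it removes one. *)
Lemma skein_twist_odd_parallel u k x1 x x4 :
  run u [::] = Some [:: x1; x; x; x4] ->
  let f j := jones_word (u ++ nseq j (1%N, cross false) ++ caps_odd) in
  t^-1 * f k - t * f k.+2 + (sqrt_t^-1 - sqrt_t) * f k.+1 = 0.
Proof.
move=> hu f; pose c : slice := (1%N, cross false).
have hu' j : run (u ++ nseq j c) [::] = Some [:: x1; x; x; x4].
  by rewrite (run_cat_some _ hu) run_twist1; case: odd.
have := @jones_word_skein (u ++ nseq k.+1 c) caps_odd [:: x1] [:: x4]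
          x x (hu' _).
rewrite /oriented_smoothing !eqxx /=.
rewrite -/c -[c :: nseq _ _]/(nseq k.+1 c).
have -> : (u ++ nseq k.+1 c) ++ (1%N, cross true) :: caps_odd
        = (u ++ nseq k c) ++ [:: c; (1%N, cross true)] ++ caps_odd.
  by rewrite -addn1 nseqD -!catA.
rewrite (jones_word_R2 _ (hu' k)) //.
have -> : (u ++ nseq k.+1 c) ++ c :: caps_odd = u ++ nseq k.+2 c ++ caps_odd.
  by rewrite -(addn1 k.+1) nseqD -!catA.
by rewrite -!catA.
Qed.

(** Between antiparallel strands [cross false] is positive, so [f k.+2] is now the $L_+$ term, and
    the smoothing opens the twist. *)
Lemma skein_twist_odd_antiparallel u k x1 x x4 :
  run u [::] = Some [:: x1; x; ~~ x; x4] ->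
  let f j := jones_word (u ++ nseq j (1%N, cross false) ++ caps_odd) in
  is_closed (u ++ nseq k (1%N, cross false) ++ caps_odd) ->
  t^-1 * f k.+2 - t * f k
  + (sqrt_t^-1 - sqrt_t) * jones_word (u ++ caps_even) = 0.
Proof.
move=> hu f; pose c : slice := (1%N, cross false).
have hu' j : run (u ++ nseq j c) [::]
           = Some [:: x1; odd j (+) x; ~~ (odd j (+) x); x4].
  by rewrite (run_cat_some _ hu) run_twist1; case: odd; case: (x).
rewrite catA (is_closed_cat _ (hu' k)) => hk.
have := @jones_word_skein (u ++ nseq k.+1 c) caps_odd [:: x1] [:: x4]
          _ _ (hu' _).
set y := odd k.+1 (+) x.
rewrite /oriented_smoothing; have -> : (y == ~~ y) = false by case: (y).
rewrite /=.
have -> : (u ++ nseq k.+1 c) ++ (1%N, cross true) :: caps_odd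
        = (u ++ nseq k c) ++ [:: c; (1%N, cross true)] ++ caps_odd.
  by rewrite -addn1 nseqD -!catA.
rewrite (jones_word_R2 _ (hu' k)) //.
have -> : (u ++ nseq k.+1 c) ++ c :: caps_odd = u ++ nseq k.+2 c ++ caps_odd.
  by rewrite -(addn1 k.+1) nseqD -!catA.
(* The left arc of the smoothing and the cap at 2 form a zigzag; straightening it leaves
   [caps_even], before which the remaining crossings are kinks. Closedness ([hk]) fixes the outer
   directions, so that both sides run alike. *)
have -> : jones_word
  ((u ++ nseq k.+1 c) ++ [:: (1%N, cap), (1%N, cup (~~ y)) & caps_odd])
  = jones_word (u ++ nseq k.+1 c ++ caps_even).
  rewrite [in RHS]catA; apply: (jones_eq_word (hu' _)).
  apply: (@jones_eq_move [:: (1%N, cap)] [:: (0%N, cap)] _ _ _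
            (move_zigzag_l 1 (~~ y))).
  by rewrite {}/y /=; move: hk; clear; case: (odd k) x x1 x4 => [] [] [] [].
by rewrite (jones_word_kinks_even _ _ hu) -!catA.
Qed.

Lemma skein_twist_even_parallel u k x x3 x4 :
  run u [::] = Some [:: x; x; x3; x4] ->
  let f j := jones_word (u ++ nseq j (0%N, cross true) ++ caps_even) in
  t^-1 * f k.+2 - t * f k + (sqrt_t^-1 - sqrt_t) * f k.+1 = 0.
Proof.
move=> hu f; pose c : slice := (0%N, cross true).
have hu' j : run (u ++ nseq j c) [::] = Some [:: x; x; x3; x4].
  by rewrite (run_cat_some _ hu) run_twist0; case: odd.
have := @jones_word_skein (u ++ nseq k.+1 c) caps_even [::] [:: x3; x4]
          x x (hu' _).
rewrite /oriented_smoothing !eqxx /=.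
rewrite -/c -[c :: nseq _ _]/(nseq k.+1 c).
have -> : (u ++ nseq k.+1 c) ++ (0%N, cross false) :: caps_even
        = (u ++ nseq k c) ++ [:: c; (0%N, cross false)] ++ caps_even.
  by rewrite -addn1 nseqD -!catA.
rewrite (jones_word_R2 _ (hu' k)) //.
have -> : (u ++ nseq k.+1 c) ++ c :: caps_even = u ++ nseq k.+2 c ++ caps_even.
  by rewrite -(addn1 k.+1) nseqD -!catA.
by rewrite -!catA.
Qed.

Lemma skein_twist_even_antiparallel u k x x3 x4 :
  run u [::] = Some [:: x; ~~ x; x3; x4] ->
  let f j := jones_word (u ++ nseq j (0%N, cross true) ++ caps_even) in
  is_closed (u ++ nseq k (0%N, cross true) ++ caps_even) ->
  t^-1 * f k - t * f k.+2
  + (sqrt_t^-1 - sqrt_t) * jones_word (u ++ caps_odd) = 0.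
Proof.
move=> hu f; pose c : slice := (0%N, cross true).
have hu' j : run (u ++ nseq j c) [::]
           = Some [:: odd j (+) x; ~~ (odd j (+) x); x3; x4].
  by rewrite (run_cat_some _ hu) run_twist0; case: odd; case: (x).
rewrite catA (is_closed_cat _ (hu' k)) => hk.
have := @jones_word_skein (u ++ nseq k.+1 c) caps_even [::] [:: x3; x4]
          _ _ (hu' _).
set y := odd k.+1 (+) x.
rewrite /oriented_smoothing; have -> : (y == ~~ y) = false by case: (y).
rewrite /=.
have -> : (u ++ nseq k.+1 c) ++ (0%N, cross false) :: caps_even
        = (u ++ nseq k c) ++ [:: c; (0%N, cross false)] ++ caps_even.
  by rewrite -addn1 nseqD -!catA.
rewrite (jones_word_R2 _ (hu' k)) //.
have -> : (u ++ nseq k.+1 c) ++ c :: caps_even = u ++ nseq k.+2 c ++ caps_even.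
  by rewrite -(addn1 k.+1) nseqD -!catA.
have -> : jones_word
  ((u ++ nseq k.+1 c) ++ [:: (0%N, cap), (0%N, cup (~~ y)) & caps_even])
  = jones_word (u ++ nseq k.+1 c ++ caps_odd).
  rewrite [in RHS]catA; apply: (jones_eq_word (hu' _)).
  (* Straightening the zigzag leaves two successive caps at 0, which far commutation turns into
     [caps_odd]. *)
  apply: (@jones_eq_trans [:: (0%N, cap); (0%N, cap)]).
    apply: (@jones_eq_move [:: (0%N, cap)] [:: (0%N, cap)] _ _ _
              (move_zigzag_l 0 (~~ y))).
    by rewrite {}/y /=; move: hk; clear; case: (odd k) x x3 x4 => [] [] [] [].
  apply: (@jones_eq_move [::] [::] _ _ _ (@move_far 0 0 cap cap isT)).
  by rewrite {}/y /=; move: hk; clear; case: (odd k) x x3 x4 => [] [] [] [].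
by rewrite (jones_word_kinks_odd _ _ hu) -!catA.
Qed.

(** * The value of a diagram as a function of its last twist *)

(** Vacuous for inconsistent directions, so that all [o1], [o2] are treated at once. The value [c]
    is meant to be independent of the orientation, which enters through the first factor. *)
Definition has_value (w : seq slice) (c : ratfun) : Prop :=
  is_closed w -> jones_word w = (sqrt_t ^+ 3) ^+ positive_crossings w [::] * c.

(** The skein recursion has step two, hence an induction on pairs of consecutive [k]. The start is
    [h0] at 0 and, after sliding the single crossing around the right arcs, [h1] at 1. *)
Lemma has_value_twist_odd u x1 x2 x3 x4 (e p : ratfun) :
  run u [::] = Some [:: x1; x2; x3; x4] ->
  has_value (u ++ caps_odd) (- sqrt_t * p) ->
  has_value (u ++ caps_even) e ->
  has_value (u ++ (0%N, cross true) :: caps_even) (q * e + p) ->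
  forall k, has_value (u ++ nseq k (1%N, cross false) ++ caps_odd)
              (- sqrt_t * (- sqrt_t^-1) ^+ k * (q * qint k * e + p)).
Proof.
move=> hu h0 he h1 k; have X0 := sqrt_t_neq0.
pose f j := u ++ nseq j (1%N, cross false) ++ caps_odd.
have hpos j : positive_crossings (f j) [::]
            = (positive_crossings u [::] + j * (x2 != x3))%N.
  rewrite (positive_crossings_cat _ hu).
  rewrite (positive_crossings_cat _ (run_twist1 _ _ _ _ _ _)).
  rewrite positive_crossings_twist1.
  by case: odd; rewrite positive_crossings_caps_odd addn0 eq_sym eqbF_neg.
have hcl j : is_closed (f j)
  = (run caps_odd (if odd j then [:: x1; x3; x2; x4]
                   else [:: x1; x2; x3; x4]) == Some [::]).
  by rewrite (is_closed_cat _ hu) (run_cat_some _ (run_twist1 _ _ _ _ _ _)).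
pose c j := - sqrt_t * (- sqrt_t^-1) ^+ j * (q * qint j * e + p).
suff: has_value (f k) (c k) /\ has_value (f k.+1) (c k.+1) by case.
rewrite {}/c /has_value.
elim: k => [|k [IHk IHk1]].
  split; first by rewrite expr0 qint0 mulr1 mulr0 mul0r add0r.
  have hs : jones_word (f 1%N)
          = jones_word (u ++ (0%N, cross true) :: caps_even).
    by apply: (jones_eq_word hu); apply: jones_eq_slide.
  have hc : is_closed (f 1%N) = is_closed (u ++ (0%N, cross true) :: caps_even).
    by rewrite !(is_closed_cat _ hu); clear; case: x1 x2 x3 x4 => [] [] [] [].
  rewrite hs {}hc qintS qint0 add0r expr0 expr1 mulr1 mulrNN divff // mul1r.
  move=> hc.
  rewrite h1 //; congr (_ ^+ _ * _).
  rewrite hpos (positive_crossings_cat _ hu); congr (_ + _)%N.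
  (* Closedness relates the four directions so that the slid crossing keeps its sign. *)
  rewrite (is_closed_cat _ hu) in hc.
  by move: hc; clear; case: x1 x2 x3 x4 => [] [] [] [].
split=> // hk.
have hk0 : is_closed (f k) by move: hk; rewrite !hcl /= negbK.
move: {IHk}(IHk hk0) => IHk; move: hk IHk IHk1.
rewrite !hpos !(exprS (- sqrt_t^-1)) !qintS !(exprS q).
have [exx|nxx] := eqVneq x2 x3.
  rewrite !muln0 addn0 => hk IHk IHk1.
  rewrite -{x3}exx in hu hpos hcl.
  have hk1 : is_closed (f k.+1).
    by move: hk; rewrite !hcl /= negbK; case: odd.
  rewrite (skein_solve_neg X0 (skein_twist_odd_parallel k hu)) -!/(f _).
  by rewrite IHk (IHk1 hk1); apply: odd_parallel_step.
rewrite !muln1 !exprD !(exprS (sqrt_t ^+ 3)) => hk IHk _.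
have ex3 : x3 = ~~ x2 by case: (x2) (x3) nxx => [] [].
rewrite {x3}ex3 in hu hpos hcl nxx.
rewrite (skein_solve_pos X0 (skein_twist_odd_antiparallel hu hk0)) -!/(f _).
have hce : is_closed (u ++ caps_even).
  rewrite (is_closed_cat _ hu); move: hk0; rewrite hcl; clear.
  by case: odd x1 x2 x4 => [] [] [] [].
rewrite IHk (he hce) (positive_crossings_cat _ hu) positive_crossings_caps_even.
rewrite addn0; apply: odd_antiparallel_step => //.
exact: odd_antiparallel_scale.
Qed.

(** The same induction with the signs exchanged: [cross true] is positive between parallel strands.
    The antiparallel step now rests on $q^k=1+(q-1)[k]_q$. *)
Lemma has_value_twist_even u x1 x2 x3 x4 (e p : ratfun) :
  run u [::] = Some [:: x1; x2; x3; x4] ->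
  has_value (u ++ caps_even) (- sqrt_t^-1 * p) ->
  has_value (u ++ caps_odd) e ->
  has_value (u ++ (1%N, cross false) :: caps_odd) (- sqrt_t^-1 * (e + q * p)) ->
  forall k, has_value (u ++ nseq k (0%N, cross true) ++ caps_even)
              (- sqrt_t^-1 * (qint k * e + q ^+ k * p)).
Proof.
move=> hu h0 he h1 k; have X0 := sqrt_t_neq0.
pose f j := u ++ nseq j (0%N, cross true) ++ caps_even.
have hpos j : positive_crossings (f j) [::]
            = (positive_crossings u [::] + j * (x1 == x2))%N.
  rewrite (positive_crossings_cat _ hu).
  rewrite (positive_crossings_cat _ (run_twist0 _ _ _ _ _ _)).
  rewrite positive_crossings_twist0.
  by case: odd; rewrite positive_crossings_caps_even addn0.
have hcl j : is_closed (f j)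
  = (run caps_even (if odd j then [:: x2; x1; x3; x4]
                    else [:: x1; x2; x3; x4]) == Some [::]).
  by rewrite (is_closed_cat _ hu) (run_cat_some _ (run_twist0 _ _ _ _ _ _)).
pose c j := - sqrt_t^-1 * (qint j * e + q ^+ j * p).
suff: has_value (f k) (c k) /\ has_value (f k.+1) (c k.+1) by case.
rewrite {}/c /has_value.
elim: k => [|k [IHk IHk1]].
  split; first by rewrite expr0 qint0 mul1r mul0r add0r.
  have hs : jones_word (f 1%N)
          = jones_word (u ++ (1%N, cross false) :: caps_odd).
    apply: (jones_eq_word hu); apply: jones_eq_sym.
    exact: (@jones_eq_slide false).
  have hc : is_closed (f 1%N) = is_closed (u ++ (1%N, cross false) :: caps_odd).
    by rewrite !(is_closed_cat _ hu); clear; case: x1 x2 x3 x4 => [] [] [] [].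
  rewrite hs {}hc qintS qint0 add0r expr0 expr1 mul1r => hc.
  rewrite h1 //; congr (_ ^+ _ * _).
  rewrite hpos (positive_crossings_cat _ hu); congr (_ + _)%N.
  rewrite (is_closed_cat _ hu) in hc.
  by move: hc; clear; case: x1 x2 x3 x4 => [] [] [] [].
split=> // hk.
have hk0 : is_closed (f k) by move: hk; rewrite !hcl /= negbK.
move: {IHk}(IHk hk0) => IHk; move: hk IHk IHk1.
rewrite !hpos !qintS !(exprS q).
have [exx|nxx] := eqVneq x1 x2; last first.
  rewrite !muln0 addn0 => hk IHk _.
  have ex2 : x2 = ~~ x1 by case: (x1) (x2) nxx => [] [].
  rewrite {x2}ex2 in hu hpos hcl nxx.
  rewrite (skein_solve_neg X0 (skein_twist_even_antiparallel hu hk0)) -!/(f _).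
  have hco : is_closed (u ++ caps_odd).
    rewrite (is_closed_cat _ hu); move: hk0; rewrite hcl; clear.
    by case: odd x1 x3 x4 => [] [] [] [].
  rewrite IHk (he hco) (positive_crossings_cat _ hu).
  rewrite positive_crossings_caps_odd addn0.
  by apply: even_antiparallel_step => //; apply: qint_geometric.
rewrite !muln1 !exprD !(exprS (sqrt_t ^+ 3)) => hk IHk IHk1.
rewrite -{x2}exx in hu hpos hcl.
have hk1 : is_closed (f k.+1).
  by move: hk; rewrite !hcl /= negbK; case: odd.
rewrite (skein_solve_pos X0 (skein_twist_even_parallel k hu)) -!/(f _).
by rewrite IHk (IHk1 hk1); apply: even_parallel_step.
Qed.

(** * Base values: the unknot and the two-component unlink *)

Lemma jones_word_unknot o : jones_word [:: (0%N, cup o); (0%N, cap)] = 1.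
Proof. by rewrite (jones_wordT (unknot_closed o)) (jones_unknot hV). Qed.

Lemma jones_word_caps_even o : jones_word (cups o o ++ caps_even) = 1.
Proof.
rewrite -(jones_word_unknot o).
have h := @jones_eq_move [:: (0%N, cup o)] [:: (0%N, cap)] [::] _ _
            (move_zigzag_r 1 o).
by have := h _ [::] [::]; rewrite /= => -> //; case: (o).
Qed.

Lemma has_value_caps_even o1 o2 : has_value (cups o1 o2 ++ caps_even) 1.
Proof.
have [<- _|ne] := eqVneq o1 o2; last by case: o1 o2 ne => [] [].
by rewrite jones_word_caps_even; case: o1; rewrite expr0 mul1r.
Qed.

(** The crossing moves past the second left arc and is then a kink on the first one; Reidemeister I
    removes it and reverses the direction of that arc. *)
Lemma jones_word_flip_cup o1 o2 s w :
  jones_word (cups o1 o2 ++ (0%N, cross s) :: w)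
  = jones_word (cups (~~ o1) o2 ++ w).
Proof.
have h1 := @jones_eq_move [:: (0%N, cup o1)] [::] [::] _ _
             (@move_far 0 0 (cross s) (cup o2) isT).
have h2 := @jones_eq_move [::] [:: (2%N, cup o2)] [::] _ _
             (move_R1_cup 0 o1 s).
have := h1 _ [::] w; rewrite /= => <- //.
by have := h2 _ [::] w; rewrite /= => -> //; case: (o1).
Qed.

Lemma has_value_one_crossing o1 o2 :
  has_value (cups o1 o2 ++ (0%N, cross true) :: caps_even) 1.
Proof.
have [->|ne] := eqVneq o2 (~~ o1); last by case: o1 o2 ne => [] [].
rewrite /has_value jones_word_flip_cup jones_word_caps_even.
by case: o1; rewrite expr0 mul1r.
Qed.

Lemma has_value_caps_odd o1 o2 :
  has_value (cups o1 o2 ++ caps_odd) (- sqrt_t * (1 - q)).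
Proof.
move=> _; rewrite (_ : positive_crossings _ _ = 0%N); last first.
  by case: o1 o2 => [] [].
rewrite expr0 mul1r; have X0 := sqrt_t_neq0.
(* A kink on the first circle can be removed at its right arc, or at its left arc with a reversal of
   direction; so the two middle strands may be taken parallel. *)
wlog -> : o1 / o1 = ~~ o2.
  move=> h; have [->|ne] := eqVneq o1 (~~ o2); first exact: h.
  have -> : o1 = ~~ ~~ o2 by move: ne; clear; case: o1 o2 => [] [].
  rewrite -(jones_word_flip_cup _ _ true) -(h (~~ o2)) //.
  by apply: (jones_eq_word (run_cups _ _)); apply: jones_eq_kink_odd.
(* A crossing of either sign between the two circles gives an unknot; its oriented smoothing is the
   unlink. *)
have h1 s : jones_word (cups (~~ o2) o2 ++ (1%N, cross s) :: caps_odd) = 1.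
  transitivity
    (jones_word (cups (~~ o2) o2 ++ (0%N, cross (~~ s)) :: caps_even)).
    by apply: (jones_eq_word (run_cups _ _)); apply: jones_eq_slide.
  by rewrite jones_word_flip_cup negbK jones_word_caps_even.
have hu : run (cups (~~ o2) o2) [::]
        = Some ([:: ~~ o2] ++ [:: o2, o2 & [:: ~~ o2]]).
  by case: (o2).
have := jones_word_skein caps_odd hu.
rewrite /oriented_smoothing eqxx !h1; exact: unlink_value sqrt_tV_neq.
Qed.

(** * Removing kinks, and the induction on the number of twists *)

(** In a closed word each kink joins antiparallel strands, where [cross true] is negative; the count
    of positive crossings is unchanged. *)
Lemma has_value_kinks_odd u x1 x2 x3 x4 b c :
  run u [::] = Some [:: x1; x2; x3; x4] ->
  has_value (u ++ caps_odd) c ->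
  has_value ((u ++ nseq b (0%N, cross true)) ++ caps_odd) c.
Proof.
rewrite /has_value -catA => hu h; rewrite (jones_word_kinks_odd _ _ hu).
rewrite !(is_closed_cat _ hu) !(positive_crossings_cat _ hu).
rewrite (run_cat_some _ (run_twist0 _ _ _ _ _ _)).
rewrite (positive_crossings_cat _ (run_twist0 _ _ _ _ _ _)).
rewrite positive_crossings_twist0 => hc; rewrite h.
  rewrite (positive_crossings_cat _ hu); congr (_ ^+ (_ + _) * _).
  rewrite positive_crossings_caps_odd; move: hc {h hu}.
  by case: (odd b); case: x1 x2 x3 x4 => [] [] [] []; rewrite //= muln0.
rewrite (is_closed_cat _ hu); move: hc {h hu}.
by case: (odd b); case: x1 x2 x3 x4 => [] [] [] [].
Qed.

(** Here the kinks [cross false] are positive: the Jones polynomial is unchanged while the count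
    grows by [b], which the new factor compensates. *)
Lemma has_value_kinks_even u x1 x2 x3 x4 b c :
  run u [::] = Some [:: x1; x2; x3; x4] ->
  has_value (u ++ caps_even) c ->
  has_value ((u ++ nseq b (1%N, cross false)) ++ caps_even)
    ((sqrt_t ^+ 3) ^- b * c).
Proof.
have X3 : (sqrt_t ^+ 3) ^+ b != 0 by rewrite !expf_neq0 // sqrt_t_neq0.
rewrite /has_value -catA => hu h; rewrite (jones_word_kinks_even _ _ hu).
rewrite !(is_closed_cat _ hu) !(positive_crossings_cat _ hu).
rewrite (run_cat_some _ (run_twist1 _ _ _ _ _ _)).
rewrite (positive_crossings_cat _ (run_twist1 _ _ _ _ _ _)).
rewrite positive_crossings_twist1 => hc; rewrite h.
  rewrite (positive_crossings_cat _ hu) positive_crossings_caps_even.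
  rewrite (_ : positive_crossings caps_even _ = 0%N); last first.
    by case: odd; rewrite positive_crossings_caps_even.
  have -> : (b * (false == (x2 == x3)))%N = b.
    move: hc {h hu}.
    by case: (odd b); case: x1 x2 x3 x4 => [] [] [] []; rewrite //= muln1.
  by rewrite !addn0 exprD -mulrA (mulrA (_ ^+ b)) mulfV ?mul1r.
rewrite (is_closed_cat _ hu); move: hc {h hu}.
by case: (odd b); case: x1 x2 x3 x4 => [] [] [] [].
Qed.

(** The induction is on the number of twists only, so the hypothesis also covers [b.+1 :: s], which
    has more crossings but one twist less than [[:: k, b & s]]. *)
Lemma has_value_twists s o1 o2 :
  has_value (cups o1 o2 ++ twists s ++ caps (size s))
    (twist_unit s * twist_poly s).
Proof.
have X0 := sqrt_t_neq0.
have [n] := ubnP (size s); elim: n s => // n IHn [|k [|b s]] hn.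
- by rewrite mulr1; apply: has_value_caps_even.
(* Here [e = 1] comes from the unknot and [p = 1 - q] from the two-component unlink. *)
- have -> : twist_unit [:: k] * twist_poly [:: k]
          = - sqrt_t * (- sqrt_t^-1) ^+ k * (q * qint k * 1 + (1 - q)).
    by rewrite /= !mulr1.
  apply: (has_value_twist_odd (run_cups _ _)).
  + exact: has_value_caps_odd.
  + exact: has_value_caps_even.
  by rewrite mulr1 addrC subrK; apply: has_value_one_crossing.
have IH1 := IHn (b :: s) hn.
have IH0 := IHn s (ltnW hn).
have IHb := IHn (b.+1 :: s) hn.
have [x1 [x2 [x3 [x4 hu]]]] := run_twists o1 o2 (b :: s).
have [y1 [y2 [y3 [y4 hs]]]] := run_twists o1 o2 s.
set u := _ ++ _ in hu; set us := _ ++ _ in hs.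
(* [size s] has the parity of the whole list, so [os] means that the last twist is odd-numbered. *)
have [os|es] := boolP (odd (size s)).
  have wk : cups o1 o2 ++ twists [:: k, b & s] ++ caps (size [:: k, b & s])
          = u ++ nseq k (1%N, cross false) ++ caps_odd.
    by rewrite /u /caps /= !negbK os /= -!catA.
  have w1 : cups o1 o2 ++ twists (b :: s) ++ caps (size (b :: s))
          = u ++ caps_even.
    by rewrite /u /caps /= os /= -!catA.
  have w0 : cups o1 o2 ++ twists s ++ caps (size s) = us ++ caps_odd.
    by rewrite /us /caps os -!catA.
  have wb : cups o1 o2 ++ twists (b.+1 :: s) ++ caps (size (b.+1 :: s))
          = u ++ (0%N, cross true) :: caps_even.
    by rewrite /u /caps twists_succ /= os /= -!catA.
  have wu : u = us ++ nseq b (0%N, cross true).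
    by rewrite /u /us /= os.
  rewrite wk.
  have -> : twist_unit [:: k, b & s] * twist_poly [:: k, b & s]
    = - sqrt_t * (- sqrt_t^-1) ^+ k
      * (q * qint k * (twist_unit (b :: s) * twist_poly (b :: s))
         + twist_unit (b :: s) * twist_poly s).
    by rewrite /= !negbK os /=; apply: mulr_distr.
  apply: (has_value_twist_odd hu).
  - rewrite wu; apply: (has_value_kinks_odd hs).
    rewrite w0 in IH0; move: IH0; congr has_value.
    by rewrite /= os /= !mulrA mulrNN divff ?mul1r.
  - by rewrite -w1.
  rewrite -wb; move: IHb; congr has_value.
  rewrite twist_poly_succ_even //.
  have -> : twist_unit (b.+1 :: s) = twist_unit (b :: s) by rewrite /= os.
  by rewrite mulrDr mulrCA.
have wk : cups o1 o2 ++ twists [:: k, b & s] ++ caps (size [:: k, b & s])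
        = u ++ nseq k (0%N, cross true) ++ caps_even.
  by rewrite /u /caps /= !negbK (negbTE es) /= -!catA.
have w1 : cups o1 o2 ++ twists (b :: s) ++ caps (size (b :: s))
        = u ++ caps_odd.
  by rewrite /u /caps /= es /= -!catA.
have w0 : cups o1 o2 ++ twists s ++ caps (size s) = us ++ caps_even.
  by rewrite /us /caps (negbTE es) -!catA.
have wb : cups o1 o2 ++ twists (b.+1 :: s) ++ caps (size (b.+1 :: s))
        = u ++ (1%N, cross false) :: caps_odd.
  by rewrite /u /caps twists_succ /= es /= -!catA.
have wu : u = us ++ nseq b (1%N, cross false).
  by rewrite /u /us /= es.
rewrite wk.
have -> : twist_unit [:: k, b & s] * twist_poly [:: k, b & s]
  = - sqrt_t^-1
    * (qint k * (twist_unit (b :: s) * twist_poly (b :: s))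
       + q ^+ k * (q ^+ b * twist_unit (b :: s) * twist_poly s)).
  by rewrite -mulr_distr3 -exprD /= !negbK (negbTE es).
have uS : twist_unit (b.+1 :: s) = - sqrt_t^-1 * twist_unit (b :: s).
  by rewrite /= es exprS !mulrA [- sqrt_t * _]mulrC.
apply: (has_value_twist_even hu).
- rewrite wu; rewrite w0 in IH0.
  move: (@has_value_kinks_even _ _ _ _ _ b _ hs IH0).
  congr has_value; rewrite [twist_unit (b :: s)]/= es.
  by rewrite kink_scale.
- by rewrite -w1.
rewrite -wb; move: IHb; congr has_value.
rewrite twist_poly_succ_odd // uS exprS -[X in _ * (X + _)]mul1r mulr_distr3.
by rewrite mul1r.
Qed.

End JonesOfWords.

(** * Comparison with the numerator of the continued fraction *)

Fixpoint twist_seq (a : nat -> nat) (n : nat) : seq nat :=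
  if n is m.+1 then a n :: twist_seq a m else [::].

Lemma size_twist_seq a n : size (twist_seq a n) = n.
Proof. by elim: n => //= n ->. Qed.

Lemma twists_twist_seq a n : twists (twist_seq a n) = conway_braid n a.
Proof.
elim: n => // n IHn.
rewrite /conway_braid -{2}addn1 iotaD map_cat flatten_cat -/(conway_braid n a).
by rewrite /= size_twist_seq IHn cats0.
Qed.

Lemma conway_wordE n a o1 o2 : conway_word n a o1 o2
  = cups o1 o2 ++ twists (twist_seq a n) ++ caps (size (twist_seq a n)).
Proof. by rewrite twists_twist_seq size_twist_seq. Qed.

Lemma q_neq0 : q != 0.
Proof. by rewrite oppr_eq0 invr_eq0 expf_neq0 ?sqrt_t_neq0. Qed.

Lemma ellS a n : ell a n.+1 = (ell a n + a n.+1)%N.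
Proof. by rewrite /ell big_nat_recr. Qed.

Lemma cf_entry_odd a n : odd n ->
  cf_entry a n.+2 = qint (a n.+2) * q ^+ (ell a n.+1).+1.
Proof. by rewrite /cf_entry /= negbK => ->. Qed.

Lemma cf_entry_even a n : ~~ odd n ->
  cf_entry a n.+2 = qint (a n.+2) * q ^- ell a n.+2.
Proof. by rewrite /cf_entry /= negbK => /negbTE ->. Qed.

(** Both sides satisfy a recursion of order two, hence the induction on pairs. For even indices
    $q^{\ell_{n+2}}$ cancels the denominator of the new entry and leaves $q^{a_{n+2}+a_{n+1}}$
    beside $q^{\ell_n}$; for odd ones $q^{\ell_{n+1}}$ comes from the new entry itself. *)
Lemma numer_cf_cf_entry a n :
  q ^+ (if odd n then 0 else ell a n) * numer_cf (cf_entry a) n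
  = twist_poly (twist_seq a n).
Proof.
suff: q ^+ (if odd n then 0 else ell a n) * numer_cf (cf_entry a) n
  = twist_poly (twist_seq a n) /\
  q ^+ (if odd n.+1 then 0 else ell a n.+1) * numer_cf (cf_entry a) n.+1
  = twist_poly (twist_seq a n.+1) by case.
elim: n => [|n [IHn IHn1]].
  rewrite /= /ell big_nil !expr0 !mul1r; split=> //.
  by rewrite /cf_entry eqxx qintSl addrAC addrC.
split=> //.
have -> : numer_cf (cf_entry a) n.+2
  = cf_entry a n.+2 * numer_cf (cf_entry a) n.+1 + numer_cf (cf_entry a) n.
  by [].
have -> : twist_poly (twist_seq a n.+2) =
   if odd n then q * qint (a n.+2) * twist_poly (twist_seq a n.+1)
                 + twist_poly (twist_seq a n)
   else qint (a n.+2) * twist_poly (twist_seq a n.+1)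
        + q ^+ (a n.+2 + a n.+1) * twist_poly (twist_seq a n).
  by rewrite [twist_seq a n.+2]/= twist_poly_cons2 size_twist_seq.
rewrite -IHn -IHn1 /= negbK.
have [on|en] := boolP (odd n); rewrite /= !expr0 !mul1r.
  rewrite cf_entry_odd // exprS; congr (_ + _).
  by rewrite !mulrA; congr (_ * _ * _); rewrite mulrC.
rewrite cf_entry_even // mulrDr; congr (_ + _).
  by rewrite -!mulrA mulrCA mulVKf // expf_neq0 // q_neq0.
rewrite mulrA -exprD !ellS; congr (_ ^+ _ * _).
by rewrite [RHS]addnC (addnC (a n.+2)) addnA.
Qed.

(** * Leading terms *)

(** Laurent polynomials in $t^{1/2}$ with negative exponents only, including 0. As [size] is the
    degree plus one, the bound says that the degree of [p] is less than [d]. *)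
Definition negative_degree (f : ratfun) : Prop :=
  exists (p : {poly int}) (d : nat), (size p <= d)%N /\ f = emb p / sqrt_t ^+ d.

Lemma emb_Xn n : emb 'X^n = sqrt_t ^+ n.
Proof. by rewrite /emb tofracXn. Qed.

Lemma negative_degreeD f g :
  negative_degree f -> negative_degree g -> negative_degree (f + g).
Proof.
move=> [p [d [pd ->]]] [p' [d' [pd' ->]]].
exists (p * 'X^d' + p' * 'X^d), (d + d')%N; split.
  rewrite (leq_trans (size_polyD _ _)) // geq_max.
  rewrite (leq_trans (size_polyMleq _ _)) ?(leq_trans (size_polyMleq _ _)) //;
  by rewrite size_polyXn addnS /= ?leq_add2r // addnC leq_add2l.
have X0 n := expf_neq0 n sqrt_t_neq0.
by rewrite /emb tofracD !tofracM -!/(emb _) !emb_Xn exprD addf_div.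
Qed.

Lemma negative_degreeN f : negative_degree f -> negative_degree (- f).
Proof.
move=> [p [d [pd ->]]]; exists (- p), d; split; first by rewrite size_polyN.
by rewrite /emb tofracN mulNr.
Qed.

Lemma negative_degreeM f g :
  negative_degree f -> negative_degree g -> negative_degree (f * g).
Proof.
move=> [p [d [pd ->]]] [p' [d' [pd' ->]]].
exists (p * p'), (d + d')%N; split.
  rewrite (leq_trans (size_polyMleq _ _)) //.
  by rewrite (leq_trans (leq_pred _)) // leq_add.
by rewrite /emb tofracM -!/(emb _) exprD mulf_div.
Qed.

Lemma negative_degree0 : negative_degree 0.
Proof. by exists 0, 0%N; rewrite size_poly0 /emb tofrac0 mul0r. Qed.

Lemma negative_degree_q : negative_degree q.
Proof.
exists (- 1), 2%N; split; first by rewrite size_polyN size_poly1.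
by rewrite /emb tofracN tofrac1 mulN1r.
Qed.

Lemma negative_degree_qX k : negative_degree (q ^+ k.+1).
Proof.
elim: k => [|k IHk]; first exact: negative_degree_q.
by rewrite exprS; apply: negative_degreeM; [exact: negative_degree_q|].
Qed.

Lemma negative_degree_q_qint k : negative_degree (q * qint k).
Proof.
elim: k => [|k IHk]; first by rewrite qint0 mulr0; apply: negative_degree0.
rewrite qintS mulrDr -exprS; apply: negative_degreeD => //.
exact: negative_degree_qX.
Qed.

Lemma negative_degree_mul f g :
  negative_degree f -> negative_degree (g - 1) -> negative_degree (f * g).
Proof.
move=> lf lg; rewrite -[g](subrK 1) mulrDr mulr1.
by apply: negative_degreeD => //; apply: negative_degreeM.
Qed.

(** The constant term 1 in $q$ is inherited from the shorter list in each recursion, all other terms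
    being divisible by $q=-t^{-1}$. *)
Lemma twist_poly_sub1 s : all (leq 1) s -> negative_degree (twist_poly s - 1).
Proof.
have [n] := ubnP (size s); elim: n s => // n IHn [|k [|b s]] hn.
- by rewrite subrr => _; apply: negative_degree0.
- move=> _; rewrite /= -addrA (addrAC 1) subrr add0r.
  apply: negative_degreeD; first exact: negative_degree_q_qint.
  by apply: negative_degreeN; apply: negative_degree_q.
move=> /and3P [k0 b0 s0].
have h1 := IHn (b :: s) hn; have h0 := IHn s (ltnW hn) s0.
have {}h1 : negative_degree (twist_poly (b :: s) - 1).
  by apply: h1; rewrite /= b0.
rewrite twist_poly_cons2; case: odd.
  rewrite -addrA; apply: negative_degreeD => //.
  by apply: negative_degree_mul => //; apply: negative_degree_q_qint.
(* Positivity enters here: $[k+1]_q=1+q[k]_q$ has constant term 1, and the exponent of $q$ in [B] is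
   positive. *)
case: k k0 {hn} => // k _; set A := twist_poly (b :: s); set B := q ^+ _ * _.
have -> : qint k.+1 * A + B - 1 = q * qint k * A + (A - 1) + B.
  by rewrite qintSl mulrDl mul1r (addrC A) addrAC -(addrA _ A).
apply: negative_degreeD; first apply: negative_degreeD => //.
  by apply: negative_degree_mul => //; apply: negative_degree_q_qint.
by apply: negative_degree_mul => //; rewrite addSn; apply: negative_degree_qX.
Qed.

Definition monomial (m : ratfun) : Prop :=
  exists (c : int) (j k : nat),
    c != 0 /\ m = emb (c *: 'X^j) / sqrt_t ^+ k.

Lemma monomialM m m' : monomial m -> monomial m' -> monomial (m * m').
Proof.
move=> [c [j [k [c0 ->]]]] [c' [j' [k' [c0' ->]]]].
exists (c * c'), (j + j')%N, (k + k')%N; split; first by rewrite mulf_neq0.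
rewrite mulf_div -exprD /emb -tofracM; congr (tofrac _ / _).
by rewrite -scalerAl -scalerAr scalerA exprD.
Qed.

Lemma monomialX m k : monomial m -> monomial (m ^+ k).
Proof.
move=> hm; elim: k => [|k IHk]; last by rewrite exprS; apply: monomialM.
by exists 1, 0%N, 0%N; rewrite scale1r /emb tofrac1 divr1.
Qed.

Lemma monomialN m : monomial m -> monomial (- m).
Proof.
move=> [c [j [k [c0 ->]]]]; exists (- c), j, k; rewrite oppr_eq0; split=> //.
by rewrite scaleNr /emb tofracN mulNr.
Qed.

Lemma monomial_sqrt_t : monomial sqrt_t.
Proof. by exists 1, 1%N, 0%N; rewrite scale1r divr1. Qed.

Lemma monomial_sqrt_tV : monomial sqrt_t^-1.
Proof. by exists 1, 0%N, 1%N; rewrite scale1r /emb tofrac1 mul1r. Qed.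

Lemma monomial_twist_unit s : monomial (twist_unit s).
Proof.
have hX := monomial_sqrt_t; have hV := monomial_sqrt_tV.
elim: s => [|k s IHs]; first exact: (monomialX 0 hX).
apply: monomialM => //; case: ifP => _; last exact: monomialN.
by apply: monomialM; [|apply: monomialX]; apply: monomialN.
Qed.

Lemma monomial_neq0 m : monomial m -> m != 0.
Proof.
move=> [c [j [k [c0 ->]]]]; apply: mulf_neq0.
  apply: (@emb_neq0 (c *: 'X^j)).
  by rewrite -size_poly_eq0 size_scale // size_polyXn.
by rewrite invr_eq0; apply/expf_neq0/sqrt_t_neq0.
Qed.

(** Over the denominator $X^d$ the factor [f] has numerator $X^d+p$ with $\deg p<d$, which is monic
    of degree $d$; multiplying by a monomial preserves this shape. *)
Lemma is_leading_term_monomial m f :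
  monomial m -> negative_degree (f - 1) -> is_leading_term (m * f) m.
Proof.
move=> [c [j [k [c0 ->]]]] [p [d [pd hf]]].
have X0 n := expf_neq0 n sqrt_t_neq0.
have {hf} -> : f = emb ('X^d + p) / sqrt_t ^+ d.
  by rewrite /emb tofracD -!/(emb _) emb_Xn mulrDl divff // -hf addrC subrK.
have pd' : (size p < size ('X^d : {poly int}))%N by rewrite size_polyXn.
have m0 : c *: 'X^j != 0 :> {poly int}.
  by rewrite -size_poly_eq0 size_scale // size_polyXn.
have s0 : 'X^d + p != 0.
  by rewrite -size_poly_gt0 size_polyDl // size_polyXn.
exists (c *: 'X^j * ('X^d + p)), (k + d)%N; split.
- by rewrite mulf_neq0.
- by rewrite mulf_div -exprD /emb -tofracM.
rewrite lead_coefM lead_coefZ lead_coefDl // !lead_coefXn !mulr1.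
rewrite size_mul // size_polyDl // size_scale // !size_polyXn addnS /=.
rewrite !exprD scalerAl /emb tofracM -!/(emb _) emb_Xn -mulf_div divff //.
by rewrite mulr1.
Qed.

(** * The quotient by the leading monomial *)

Theorem theorem1p2 (V : diagram -> ratfun) (hV : is_jones V)
    (n : nat) (a : nat -> nat) (hn : (0 < n)%N)
    (ha : forall i : nat, (1 <= i <= n)%N -> (0 < a i)%N)
    (o1 o2 : bool) (D : diagram) (hD : word D = conway_word n a o1 o2) :
  exists m : ratfun,
    [/\ is_leading_term (V D) m,
        odd n -> V D / m = numer_cf (cf_entry a) n
      & ~~ odd n -> V D / m = q ^+ ell a n * numer_cf (cf_entry a) n].
Proof.
have hw := @has_value_twists V hV (twist_seq a n) o1 o2.
rewrite -conway_wordE -hD in hw.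
move: (hw (word_closed D)); rewrite jones_wordE mulrA => {hw}.
(* The candidate leading term: the contribution of the positive crossings times the orientation-free
   unit. *)
set m := _ * twist_unit _ => hVD.
have hm : monomial m.
  apply: monomialM; last exact: monomial_twist_unit.
  by do 2 apply: monomialX; apply: monomial_sqrt_t.
have pos_seq : all (leq 1) (twist_seq a n).
  elim: n ha {hn hD m hVD hm} => //= n IHn ha.
  rewrite ha ?leqnn // IHn // => i /andP [i0 ilen].
  by rewrite ha // i0 leqW.
have hquo : V D / m = twist_poly (twist_seq a n).
  by rewrite hVD mulrAC divff ?mul1r // monomial_neq0.
exists m; split.
- rewrite hVD; apply: is_leading_term_monomial => //.
  exact: twist_poly_sub1.
- by move=> on; rewrite hquo -numer_cf_cf_entry on expr0 mul1r.
- by move=> /negbTE en; rewrite hquo -numer_cf_cf_entry en.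
Qed.
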